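(* Let $A$ be an algebra over a field $\mathbb F$ and let $I$ be an ideal of $A$ contained in the Jacobson radical $\operatorname{Jac}(A)$. Then $A$ is a GKŻ algebra if and only if $A/I$ is a GKŻ algebra.
   Context: All algebras are nonzero, associative, unital, not necessarily commutative; ideal means two-sided ideal. $\mathcal U(A)$ denotes the group of units of $A$. A unital algebra $A$ over a field $\mathbb F$ is a GKŻ algebra if every linear functional $\Lambda:A\to\mathbb F$ such that $\Lambda(u)\neq0$ for all $u\in\mathcal U(A)$ and $\Lambda(\mathbf 1_A)=1$ is multiplicative. $\operatorname{Jac}(A)$ is the intersection of all maximal left ideals of $A$ (equivalently, of all maximal right ideals). *)

(* Defs.v *)
From HB Require Import structures.
From mathcomp Require Import all_boot all_algebra.
From mathcomp Require Import boolp classical_sets.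

Set Implicit Arguments.
Unset Strict Implicit.
Unset Printing Implicit Defensive.

Import GRing.Theory.
Local Open Scope ring_scope.
Local Open Scope classical_set_scope.
Local Open Scope quotient_scope.

(* [GRing.unit] would require a [unitRingType], that is, units chosen as part
   of the structure of the ring. *)
Definition invertible (A : nzRingType) : set A :=
  [set u | exists v, u * v = 1 /\ v * u = 1].

(* An [algType F] is nonzero, associative and unital; [{scalar A}] is the type
   of linear functionals on [A]. *)
Definition GKZ_algebra (F : fieldType) (A : algType F) : Prop :=
  forall Lambda : {scalar A},
    (forall u, invertible u -> Lambda u <> 0) -> Lambda 1 = 1 ->
    {morph Lambda : x y / x * y}.

(* Closure under opposites, and under scalars when the ring is an algebra,
   follows since the ring is unital. *)
Definition left_ideal (A : nzRingType) (I : set A) : Prop :=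
  [/\ I 0, forall x y, I x -> I y -> I (x + y)
         & forall a x, I x -> I (a * x)].

Definition two_sided_ideal (A : nzRingType) (I : set A) : Prop :=
  left_ideal I /\ forall x a, I x -> I (x * a).

Definition maximal_left_ideal (A : nzRingType) (M : set A) : Prop :=
  [/\ left_ideal M, M <> setT
    & forall L, left_ideal L -> L <> setT -> M `<=` L -> L = M].

Definition Jac (A : nzRingType) : set A :=
  \bigcap_(M in @maximal_left_ideal A) M.
Arguments Jac A : clear implicits.

Lemma left_ideal1 (A : nzRingType) (I : set A) :
  left_ideal I -> I 1 -> I = setT.
Proof.
case=> _ _ IM I1; apply/seteqP; split=> // x _.
by rewrite -[x]mulr1; apply: IM.
Qed.

Lemma maximal_left_ideal_exists (A : nzRingType) :
  exists M : set A, maximal_left_ideal M.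
Proof.
(* [X = set0] is allowed, so that the empty chain has an upper bound. *)
pose P (X : set A) := X = set0 \/ left_ideal X /\ X <> setT.
have chainP (C : set (set A)) : C `<=` P -> total_on C subset ->
    P (\bigcup_(X in C) X).
  move=> CP Ctot; have [[X CX X0]|noX] := pselect (exists2 X, C X & X 0).
    have CL Y y : C Y -> Y y -> left_ideal Y /\ Y <> setT.
      by move=> CY Yy; case: (CP _ CY) => // Y0; rewrite Y0 in Yy.
    right; split; first split.
    - by exists X.
    - move=> x y [Y CY Yx] [Z CZ Zy].
      have [[_ YD _] _] := CL _ _ CY Yx.
      have [[_ ZD _] _] := CL _ _ CZ Zy.
      case: (Ctot _ _ CY CZ) => [YZ|ZY].
        by exists Z => //; apply: ZD => //; apply: YZ.
      by exists Y => //; apply: YD => //; apply: ZY.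
    - move=> a x [Y CY Yx]; have [[_ _ YM] _] := CL _ _ CY Yx.
      by exists Y => //; apply: YM.
    - move=> UT; have [Y CY Y1] : (\bigcup_(X in C) X) 1 by rewrite UT.
      by have [/left_ideal1/(_ Y1)] := CL _ _ CY Y1.
  left; apply/seteqP; split=> // x [Y CY Yx].
  have [Y0|[[Y0 _ _] _]] := CP _ CY; first by rewrite Y0 in Yx.
  by case: noX; exists Y.
have [M [PM maxM]] := Zorn_bigcup chainP.
have id0 : left_ideal [set (0 : A)].
  by split=> [|x y /= -> ->|a x /= ->] //=; rewrite ?addr0 ?mulr0.
have p0 : [set (0 : A)] <> setT.
  by move=> E; have: [set: A] 1 by []; rewrite -E => /eqP; rewrite oner_eq0.
have [M0|[idM pM]] := PM.
  exfalso; apply: (maxM [set 0]); last by right.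
  by rewrite M0; split=> // /(_ 0 erefl).
exists M; split=> // L idL pL ML; apply: contrapT => LM.
apply: (maxM L); last by right.
by split=> // LM'; apply: LM; apply/seteqP.
Qed.

Lemma Jac1 (A : nzRingType) : ~ Jac A 1.
Proof.
have [M maxM] := maximal_left_ideal_exists A.
by move=> /(_ M maxM) M1; case: maxM => /left_ideal1/(_ M1).
Qed.

Lemma subset_Jac_proper (A : nzRingType) (I : set A) :
  I `<=` Jac A -> ~ I 1.
Proof. by move=> IJ /IJ/Jac1. Qed.

(* MathComp equips [Quotient.quot] with a ring structure only when the ambient
   ring is commutative, hence the construction below. *)
Section Quotient.
Variables (A : nzRingType) (I : set A).

Definition ideal_pred (idI : two_sided_ideal I) : {pred A} := fun x => x \in I.

Fact ideal_zmod_closed (idI : two_sided_ideal I) : zmod_closed (ideal_pred idI).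
Proof.
have [[I0 ID IM] _] := idI; split; first exact/mem_set.
move=> x y /set_mem Ix /set_mem Iy; apply/mem_set.
by apply: ID => //; rewrite -mulN1r; apply: IM.
Qed.

HB.instance Definition _ (idI : two_sided_ideal I) :=
  GRing.isZmodClosed.Build A (ideal_pred idI) (ideal_zmod_closed idI).

(* Properness does not enter the carrier; it is an argument because the ring
   structure is nonzero only when [I] is proper. *)
Definition quotient (idI : two_sided_ideal I) (properI : ~ I 1) : Type :=
  Quotient.quot (ideal_pred idI).

Variables (idI : two_sided_ideal I) (properI : ~ I 1).
Local Notation Q := (quotient idI properI).

HB.instance Definition _ := GRing.Zmodule.on Q.
HB.instance Definition _ := ZmodQuotient.on Q.

Lemma eq_quotient (x y : A) : \pi_Q x = \pi_Q y <-> I (x - y).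
Proof.
have E : (x - y \in ideal_pred idI) = (\pi_Q x == \pi_Q y).
  exact: Quotient.idealrBE.
split=> [/eqP|Ixy]; first by rewrite -E => /set_mem.
by apply/eqP; rewrite -E; apply/mem_set.
Qed.

Lemma eq_quotient_repr (x : A) : I (x - repr (\pi_Q x)).
Proof. by apply/eq_quotient; rewrite reprK. Qed.

Definition quotient_one : Q := lift_cst Q 1.
Definition quotient_mul := lift_op2 Q *%R.

Lemma pi_quotient_one : \pi_Q 1 = quotient_one.
Proof. by unlock quotient_one. Qed.

Lemma pi_quotient_mul : {morph \pi_Q : x y / x * y >-> quotient_mul x y}.
Proof.
have [[_ ID IM] Ir] := idI; move=> x y; unlock quotient_mul; apply/eq_quotient.
set x' := repr _; set y' := repr _.
have -> : x * y - x' * y' = (x - x') * y + x' * (y - y').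
  by rewrite mulrBl mulrBr addrA addrNK.
by apply: ID; [apply: Ir|apply: IM]; apply: eq_quotient_repr.
Qed.

Fact quotient_mulA : associative quotient_mul.
Proof.
elim/quotW=> x; elim/quotW=> y; elim/quotW=> z.
by rewrite -!pi_quotient_mul mulrA.
Qed.

Fact quotient_mul1l : left_id quotient_one quotient_mul.
Proof. by elim/quotW=> x; rewrite -pi_quotient_one -pi_quotient_mul mul1r. Qed.

Fact quotient_mul1r : right_id quotient_one quotient_mul.
Proof. by elim/quotW=> x; rewrite -pi_quotient_one -pi_quotient_mul mulr1. Qed.

Fact quotient_mulDl : left_distributive quotient_mul +%R.
Proof.
elim/quotW=> x; elim/quotW=> y; elim/quotW=> z.
by rewrite -!raddfD -!pi_quotient_mul mulrDl raddfD.
Qed.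

Fact quotient_mulDr : right_distributive quotient_mul +%R.
Proof.
elim/quotW=> x; elim/quotW=> y; elim/quotW=> z.
by rewrite -!raddfD -!pi_quotient_mul mulrDr raddfD.
Qed.

Fact quotient_one_neq0 : quotient_one != 0.
Proof.
apply/eqP; rewrite -pi_quotient_one -(raddf0 \pi_Q) => /eq_quotient.
by rewrite subr0.
Qed.

HB.instance Definition _ :=
  GRing.Zmodule_isNzRing.Build Q quotient_mulA quotient_mul1l quotient_mul1r
    quotient_mulDl quotient_mulDr quotient_one_neq0.

HB.instance Definition _ :=
  @isNzRingQuotient.Build A (Quotient.equiv (ideal_pred idI)) 0 -%R +%R 1 *%R
    Q pi_quotient_one pi_quotient_mul.

End Quotient.

Section QuotientAlgebra.
Variables (F : fieldType) (A : algType F) (I : set A).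
Variables (idI : two_sided_ideal I) (properI : ~ I 1).
Local Notation Q := (quotient idI properI).

Definition quotient_scale (c : F) := lift_op1 Q ( *:%R c).

Lemma pi_quotient_scale (c : F) (x : A) :
  \pi_Q (c *: x) = quotient_scale c (\pi_Q x).
Proof.
unlock quotient_scale; apply/eq_quotient; rewrite -scalerBr -mulr_algl.
by have [[_ _ IM] _] := idI; apply: IM; apply: eq_quotient_repr.
Qed.

Fact quotient_scaleA (a b : F) (x : Q) :
  quotient_scale a (quotient_scale b x) = quotient_scale (a * b) x.
Proof. by elim/quotW: x => x; rewrite -!pi_quotient_scale scalerA. Qed.

Fact quotient_scale1 : left_id 1 quotient_scale.
Proof. by elim/quotW=> x; rewrite -pi_quotient_scale scale1r. Qed.

Fact quotient_scaleDr : right_distributive quotient_scale +%R.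
Proof.
move=> c; elim/quotW=> x; elim/quotW=> y.
by rewrite -!raddfD -!pi_quotient_scale scalerDr raddfD.
Qed.

Fact quotient_scaleDl (x : Q) :
  {morph quotient_scale^~ x : a b / a + b}.
Proof.
move=> a b; elim/quotW: x => x.
by rewrite -!pi_quotient_scale scalerDl raddfD.
Qed.

HB.instance Definition _ :=
  GRing.Zmodule_isLmodule.Build F Q quotient_scaleA quotient_scale1
    quotient_scaleDr quotient_scaleDl.

HB.instance Definition _ :=
  GRing.isScalable.Build F A Q *:%R \pi_Q pi_quotient_scale.

Fact quotient_scaleAl (c : F) (x y : Q) : c *: (x * y) = c *: x * y.
Proof.
elim/quotW: x => x; elim/quotW: y => y; rewrite -rmorphM -!linearZ -rmorphM /=.
by rewrite scalerAl.
Qed.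

HB.instance Definition _ :=
  GRing.Lmodule_isLalgebra.Build F Q quotient_scaleAl.

Fact quotient_scaleAr (c : F) (x y : Q) : c *: (x * y) = x * (c *: y).
Proof.
elim/quotW: x => x; elim/quotW: y => y; rewrite -rmorphM -!linearZ -rmorphM /=.
by rewrite scalerAr.
Qed.

HB.instance Definition _ :=
  GRing.Lalgebra_isAlgebra.Build F Q quotient_scaleAr.

End QuotientAlgebra.

(* Main.v *)
(* An element [1 + j] with [j] in [I] is a unit, because [I] lies in the Jacobson
   radical. For an admissible functional [Lambda] on [A] this gives
   [1 + c * Lambda j <> 0] for every scalar [c], hence [Lambda j = 0]; so [Lambda]
   factors through [A / I]. As units of [A / I] lift to units of [A], the
   induced functional is again admissible. *)
From HB Require Import structures.
Require Import Defs.
From mathcomp Require Import all_boot all_algebra.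
From mathcomp Require Import boolp classical_sets.
Import GRing.Theory.
Local Open Scope ring_scope.
Local Open Scope classical_set_scope.

Lemma left_ideal_sub_maximal (A : nzRingType) (L : set A) :
  left_ideal L -> ~ L 1 -> exists2 M, maximal_left_ideal M & L `<=` M.
Proof.
move=> idL L1.
(* Joining [L] to each [X] lets the empty chain have the upper bound [set0]. *)
pose P (X : set A) := left_ideal (X `|` L) /\ ~ (X `|` L) 1.
have chainP (C : set (set A)) : C `<=` P -> total_on C subset ->
    P (\bigcup_(X in C) X).
  move=> CP Ctot; have [-> | /set0P[X0 CX0]] := eqVneq C set0.
    by rewrite bigcup_set0 /P set0U.
  (* Nonemptiness of [C] matters here: the member [X0] is what puts [L] inside the right-hand
     union. *)
  have UE : \bigcup_(X in C) X `|` L = \bigcup_(X in C) (X `|` L).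
    apply/seteqP; split=> x.
      by move=> [[X CX Xx]|Lx]; [exists X => //; left | exists X0 => //; right].
    by move=> [X CX [Xx|Lx]]; [left; exists X | right].
  rewrite /P UE; split; last by move=> [X /CP[_ X1]] /X1.
  split.
  - by exists X0 => //; right; case: idL.
  - move=> x y [X CX Xx] [Y CY Yy].
    have [/(@setSU _ L) XY|/(@setSU _ L) YX] := Ctot _ _ CX CY.
      by exists Y => //; have [[_ YD _] _] := CP _ CY; apply/YD/Yy/XY.
    by exists X => //; have [[_ XD _] _] := CP _ CX; apply/XD/YX.
  - move=> a x [X CX Xx]; exists X => //.
    by have [[_ _ XM] _] := CP _ CX; apply: XM.
have [M [[idM M1] maxM]] := Zorn_bigcup chainP.
exists (M `|` L); last exact: subsetUr.
split=> [//| MT |N idN pN MN]; first by apply: M1; rewrite MT.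
(* As [N] absorbs [L], it is itself a candidate for Zorn, so it cannot strictly contain [M]. *)
have NL : N `|` L = N by apply/setUidl => x Lx; apply: MN; right.
apply: contrapT => NM; apply: (maxM N).
  split; first by move=> x Mx; apply: MN; left.
  by move=> NsubM; apply: NM; apply/seteqP; split=> // x /NsubM; left.
by rewrite /P NL; split=> // /(left_ideal1 idN).
Qed.

(** Otherwise the left ideal generated by [1 + j] lies in a maximal one, which also contains [j] and
    hence [1]. *)
Lemma Jac_left_inverse (A : nzRingType) (j : A) :
  Jac A j -> exists y, y * (1 + j) = 1.
Proof.
move=> Jj; apply: contrapT => noinv.
have idL : left_ideal (range (fun y => y * (1 + j))).
  split=> [|_ _ [y _ <-] [z _ <-]|a _ [y _ <-]].
  - by exists 0; rewrite ?mul0r.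
  - by exists (y + z); rewrite ?mulrDl.
  - by exists (a * y); rewrite ?mulrA.
have [|M maxM LM] := left_ideal_sub_maximal _ _ idL.
  by move=> [y _ y1]; apply: noinv; exists y.
have [idM MT _] := maxM; apply: MT; apply: left_ideal1 => //.
have [_ MD MM] := idM.
rewrite -(addrK j 1) -(mulN1r j); apply: MD; last by apply: MM; apply: Jj.
by apply: LM; exists 1; rewrite ?mul1r.
Qed.

(** A left inverse [y] of [1 + j] equals [1 - y * j], so it has a left inverse [z] by the same
    argument. Having [z] on its left and [1 + j] on its right as inverses, [y] forces
    [z = 1 + j]. *)
Lemma Jac_invertible (A : nzRingType) (I : set A) (j : A) :
  left_ideal I -> I `<=` Jac A -> I j -> invertible (1 + j).
Proof.
move=> [_ _ IM] IJ Ij; have [y yj] := Jac_left_inverse _ _ (IJ _ Ij).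
have [z zy] : exists z, z * y = 1.
  have -> : y = 1 + - y * j by rewrite -[X in X + _]yj mulrDr mulr1 mulNr addrK.
  by apply: Jac_left_inverse; apply: IJ; apply: IM.
have zE : z = 1 + j by rewrite -[LHS]mulr1 -[X in z * X]yj mulrA zy mul1r.
by exists y; split=> //; rewrite -zE.
Qed.

(** The two products give [u] a right inverse [v * a] and a left inverse [b * v], which must
    coincide. *)
Lemma invertible_of_mul (A : nzRingType) (u v : A) :
  invertible (u * v) -> invertible (v * u) -> invertible u.
Proof.
move=> [a [uva _]] [b [_ bvu]]; exists (v * a); rewrite mulrA; split=> //.
suff -> : v * a = b * v by rewrite -mulrA.
by rewrite -[v * a]mul1r -bvu -!mulrA [u * _]mulrA uva mulr1.
Qed.

Lemma invertible_pi (A : nzRingType) (I : set A) (idI : two_sided_ideal I)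
    (properI : ~ I 1) (u : A) :
  invertible u -> invertible (\pi_(quotient idI properI) u)%qT.
Proof.
move=> [v [uv vu]]; exists (\pi_(quotient idI properI) v)%qT.
by rewrite -!rmorphM uv vu rmorph1.
Qed.

(** If [v] represents the inverse class, [u * v] and [v * u] are both [1] modulo [I], hence
    units. *)
Lemma invertible_pi_lift (A : nzRingType) (I : set A) (idI : two_sided_ideal I)
    (properI : ~ I 1) (u : A) :
  I `<=` Jac A -> invertible (\pi_(quotient idI properI) u)%qT -> invertible u.
Proof.
move=> IJ [q]; elim/quotW: q => v.
have lift x : (\pi_(quotient idI properI) x = 1)%qT -> invertible x.
  rewrite -(rmorph1 (\pi_(quotient idI properI))%qT) => /eq_quotient Ix.
  by rewrite -(subrK 1 x) addrC; apply: (Jac_invertible _ _ _ _ IJ Ix); case: idI.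
by rewrite -!rmorphM => -[/lift uv /lift vu]; exact: (invertible_of_mul _ _ _ uv vu).
Qed.

Lemma scalar_eq0_on_Jac (F : fieldType) (A : algType F) (I : set A)
    (Lambda : {scalar A}) :
  left_ideal I -> I `<=` Jac A ->
  (forall u, invertible u -> Lambda u <> 0) -> Lambda 1 = 1 ->
  forall j, I j -> Lambda j = 0.
Proof.
move=> idI IJ Lu L1 j Ij; apply: contrapT => /eqP Lj0.
(* The scalar is chosen so that [Lambda] kills the unit obtained by adding [1]. *)
have Icj : I (- (Lambda j)^-1 *: j).
  by rewrite -mulr_algl; case: idI => _ _; apply.
apply: (Lu _ (Jac_invertible _ _ _ idI IJ Icj)).
by rewrite linearD linearZ /= L1 mulNr mulVf // subrr.
Qed.

Section QuotientScalar.
Variables (F : fieldType) (A : algType F) (I : set A).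
Variables (idI : two_sided_ideal I) (properI : ~ I 1).
Variables (Lambda : {scalar A}) (LI : forall j, I j -> Lambda j = 0).
Local Notation Q := (quotient idI properI).

Let f (q : Q) : F := Lambda (repr q).

(** The choice of representative is harmless: it differs from [x] by an element of [I], where
    [Lambda] vanishes. *)
Let f_pi (x : A) : f (\pi_Q x)%qT = Lambda x.
Proof.
apply/eqP; rewrite eq_sym -subr_eq0 -linearB LI //.
exact: eq_quotient_repr.
Qed.

Let f_linear : scalar f.
Proof.
move=> c; elim/quotW=> x; elim/quotW=> y.
by rewrite -linearP !f_pi linearP.
Qed.

HB.instance Definition _ := GRing.isLinear.Build F Q F *%R f f_linear.

Lemma scalar_quotient :
  exists Lambda' : {scalar Q}, forall x, Lambda' (\pi_Q x)%qT = Lambda x.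
Proof. by exists f. Qed.

End QuotientScalar.

Theorem proposition2p21 (F : fieldType) (A : algType F) (I : set A)
    (idI : two_sided_ideal I) (IJac : I `<=` Jac A) :
  GKZ_algebra A <-> GKZ_algebra (quotient idI (subset_Jac_proper IJac)).
Proof.
set Q := quotient _ _; split=> GKZ Lambda Lu L1.
  (* The pullback is admissible because units map to units; multiplicativity descends because the
     projection is surjective. *)
  pose Lpi : {scalar A} := Lambda \o \pi_Q%qT.
  have LpiM : {morph Lpi : x y / x * y}.
    apply: GKZ => [u uU|]; first by apply: Lu; apply: invertible_pi.
    by rewrite /= rmorph1.
  elim/quotW=> x; elim/quotW=> y; by rewrite -rmorphM; apply: LpiM.
have LI : forall j, I j -> Lambda j = 0.
  by apply: (scalar_eq0_on_Jac _ _ _ _ _ IJac Lu L1); have [] := idI.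
have [L' L'E] := scalar_quotient _ _ _ idI (subset_Jac_proper IJac) _ LI.
have L'M : {morph L' : x y / x * y}.
  apply: GKZ => [|]; last by rewrite -(rmorph1 \pi_Q%qT) L'E.
  by elim/quotW=> u /(invertible_pi_lift _ _ _ _ _ IJac)/Lu; rewrite L'E.
by move=> x y; rewrite -!L'E rmorphM; apply: L'M.
Qed.
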